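(* Let $\kappa>0$ and let $\Theta(t)=(\theta_1(t),\dots,\theta_N(t))$, $t\ge0$, be a solution of $$\dot\theta_j=\frac{\kappa}{N}\sum_{k=1}^N\cos(\theta_k-\theta_j+\alpha),\qquad \theta_j(0)=\theta_j^0,\qquad j=1,\dots,N,$$ and let $R(t):=\Big|\frac1N\sum_{j=1}^N e^{\mathrm i\theta_j(t)}\Big|$. Then the following dichotomy holds. (1) If the frustration and initial data satisfy $$\alpha\in\Big(0,\frac{\pi}{2}\Big),\qquad \max_{1\le i,j\le N}|\theta_i^0-\theta_j^0|<2\alpha,$$ then complete phase synchronization emerges: $\lim_{t\to\infty}R(t)=1$. (2) If the frustration and initial data satisfy $$\alpha\in\Big(-\frac{\pi}{2},0\Big),\qquad \theta_i^0\neq\theta_j^0\quad\text{for } 1\le i\neq j\le N,$$ then complete incoherence emerges: $\lim_{t\to\infty}R(t)=0$.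
   Context: The phases $\theta_j$ are real-valued functions of time. The system is the Kuramoto model for identical oscillators with frustration $\alpha$ and coupling strength $\kappa$, written in cosine form; $R$ is the Kuramoto order parameter. Part (1) is attributed to earlier literature.
   Formalization: The coupling is corrected to cos(θ_j − θ_k + α), since both parts fail for N=2 with the printed sign; part (2) assumes N ≥ 2 and that initial phases are distinct modulo 2π, since R ≡ 1 for N = 1 or for phases 0 and 2π. *)

(* Defs.v *)
From HB Require Import structures.
From mathcomp Require Import all_boot all_order all_algebra.
From mathcomp Require Import all_classical all_reals all_analysis.
From mathcomp.real_closed Require Import complex.

Set Implicit Arguments.
Unset Strict Implicit.
Unset Printing Implicit Defensive.

Import Order.TTheory GRing.Theory Num.Theory.
Import numFieldNormedType.Exports.

Local Open Scope classical_set_scope.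
Local Open Scope ring_scope.

Definition expi (R : realType) (x : R) : R[i] := Complex (cos x) (sin x).

(* [ComplexField.Normc.normc] is the modulus with values in [R]; the norm
   [`|z|] of [z : R[i]] is itself an element of [R[i]]. *)
Definition order_parameter (R : realType) (N : nat) (theta : 'I_N -> R -> R)
    (t : R) : R :=
  ComplexField.Normc.normc (N%:R^-1 * \sum_(j < N) expi (theta j t)).

(* The default value 0 of the iterated maximum is harmless: the quantities
   are nonnegative. *)
Definition phase_diameter (R : realType) (N : nat) (x : 'I_N -> R) : R :=
  \big[Num.max/0]_(i < N) \big[Num.max/0]_(j < N) `|x i - x j|.

(* The right-hand side has the phase difference [theta j - theta k]: with
   this orientation alpha in (0, pi/2) is attractive and alpha in (-pi/2, 0)
   is repulsive (with [theta k - theta j] the roles are exchanged, and both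
   halves of the dichotomy fail). *)
Definition kuramoto_field (R : realType) (N : nat) (kappa alpha : R)
    (x : 'I_N -> R) (j : 'I_N) : R :=
  kappa / N%:R * \sum_(k < N) cos (x j - x k + alpha).

(* Solution on [0, +oo) with initial data [theta0]. Only continuity is asked
   at t = 0; the one-sided differential equation there then follows, since the
   right-hand side is continuous on [0, +oo). *)
Definition kuramoto_solution (R : realType) (N : nat) (kappa alpha : R)
    (theta0 : 'I_N -> R) (theta : 'I_N -> R -> R) : Prop :=
  forall j : 'I_N,
    [/\ {within `[0, +oo[, continuous (theta j)},
        theta j 0 = theta0 j &
        forall t : R, 0 < t ->
          is_derive t (1 : R) (theta j)
            (kuramoto_field kappa alpha (fun k => theta k t) j)].

(* Pairwise distinct as points of the circle R / 2 pi Z. *)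
Definition distinct_phases (R : realType) (N : nat) (x : 'I_N -> R) : Prop :=
  forall (i j : 'I_N) (m : int), i != j -> x i - x j != m%:~R * (2 * pi).

(* Main.v *)
Require Import Defs.
From mathcomp Require Import all_boot all_order all_algebra.
From mathcomp Require Import all_classical all_reals all_analysis.
From mathcomp Require Import ring lra.
From mathcomp.real_closed Require Import complex.
Import Order.TTheory GRing.Theory Num.Theory.
Import numFieldNormedType.Exports.
Local Open Scope classical_set_scope.
Local Open Scope ring_scope.

(* Repulsive case. The product [P] over [i != j] of [sin ((theta i - theta j) / 2)]
   satisfies [P' = C R^2 P] with [C = - kappa N (N - 1) sin alpha > 0], and
   [|P| <= 1]. Distinct initial phases give [P != 0], so [P^2] is nondecreasing
   and bounded, hence [R^2] is integrable; its derivative being bounded, it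
   tends to 0 (Barbalat).
   Attractive case. For the extremal pair of phases, at distance [F],
   [(theta i - theta j)'] is [- 2 kappa / N * sin (F / 2)] times the sum over [k] of
   [sin ((theta i + theta j) / 2 - theta k + alpha)], whose arguments lie in
   [alpha +- F / 2], inside [(0, 2 alpha)]. Hence the diameter cannot touch a
   slowly decaying exponential barrier from below.
   Both arguments start at a small positive time, where the phases are
   differentiable and the strict initial conditions still hold. *)

(** * Real analysis: mean values, a barrier principle, Barbalat's argument *)

Lemma MVT_derive (R : realType) (f df : R -> R) (a b : R) : a < b ->
  (forall x, a <= x <= b -> is_derive x 1 f (df x)) ->
  exists2 c, a < c < b & f b - f a = df c * (b - a).
Proof.
move=> ab dfE; have [||c] := @MVT R f df a b ab.
- by move=> x; rewrite in_itv/= => /andP[ax xb]; apply: dfE; rewrite !ltW.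
- apply: derivable_within_continuous => x; rewrite in_itv/= => xab.
  by case: (dfE x xab).
- by rewrite in_itv/= => cab fE; exists c.
Qed.

Lemma near_left_gt_derive_lt0 (R : realType) (f : R -> R) (x d : R) :
  is_derive x 1 f d -> d < 0 -> \forall y \near x^'-, f x < f y.
Proof.
move=> [df <-] d0.
have : \forall h \near 0^', h^-1 *: (f (h *: 1 + x) - f x) < 0.
  exact: (cvgr_lt _ df).
rewrite near_withinE => -[e /= e0 H]; rewrite near_withinE.
exists e => //= y xye yx.
have := H (y - x).
rewrite /ball_/= sub0r normrN distrC => /(_ xye); rewrite subr_eq0 lt_eqF//.
move=> /(_ isT); rewrite /GRing.scale/= mulr1 subrK.
by rewrite nmulr_rlt0 ?invr_lt0 ?subr_lt0// subr_gt0.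
Qed.

(* At the first time some [g p] vanishes, [g p] was negative before, so its
   derivative there cannot be negative. *)
Lemma barrier (R : realType) (I : finType) (g dg : I -> R -> R) (a : R) :
  (forall p t, a <= t -> is_derive t 1 (g p) (dg p t)) ->
  (forall p, g p a < 0) ->
  (forall p t, a < t -> (forall q, g q t <= 0) -> g p t = 0 -> dg p t < 0) ->
  forall p t, a <= t -> g p t < 0.
Proof.
move=> gE ga0 dg0 p0 T aT; rewrite ltNge; apply/negP => gT.
pose E := [set t | a <= t /\ exists p, 0 <= g p t].
have ET : E T by split=> //; exists p0.
have hE : has_inf E by split; [exists T|exists a => t []].
pose s := inf E.
have as_ : a <= s by apply: lb_le_inf => [|t []//]; exists T.
have below p t : a <= t -> t < s -> g p t < 0.
  move=> at_ ts; rewrite ltNge; apply/negP => gt.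
  have : s <= t by apply: ge_inf; [exact: hE.2|split=> //; exists p].
  by rewrite leNgt ts.
have cg p : g p x @[x --> s] --> g p s.
  by apply/differentiable_continuous/derivable1_diffP; case: (gE p s as_).
have [p gps] : exists p, 0 <= g p s.
  (* If every [g p s] were negative, continuity and finiteness of [I] would keep all of them
     negative on a common neighbourhood of [s], contradicting that [s] is the infimum of [E]. *)
  apply: contrapT => /forallNP H.
  have : \forall t \near s, forall p, g p t < 0.
    apply: (filter_forall (nbhs_filter s)) => p.
    by apply: (cvgr_lt _ (cg p)); rewrite ltNge; apply/negP/H.
  move=> /nbhs_ballP[e /= e0 He].
  have [t [at_ [q gq]] te] := inf_adherent e0 hE.
  have st : s <= t by apply: ge_inf; [exact: hE.2|split=> //; exists q].
  have : g q t < 0.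
    by apply: He; rewrite /ball/= distrC ger0_norm ?subr_ge0// ltrBlDl.
  by rewrite ltNge gq.
have {}as_ : a < s.
  rewrite lt_neqAle as_ andbT; apply/eqP => aE.
  by move: gps; rewrite -aE leNgt ga0.
have gs q : g q s <= 0.
  rewrite leNgt; apply/negP => gq.
  have [t [ts at_ gt]] : exists t, [/\ t < s, a < t & 0 < g q t].
    apply: (@filter_ex _ s^'-); near=> t; split; near: t.
    - exact: nbhs_left_lt.
    - exact: nbhs_left_gt.
    - exact: (cvgr_gt _ (cvg_at_left_filter (cg q))).
  by have := below q t (ltW at_) ts; rewrite ltNge (ltW gt).
have gp0 : g p s = 0 by apply/eqP; rewrite eq_le gs gps.
have [t [ts at_ gt]] : exists t, [/\ t < s, a < t & 0 < g p t].
  apply: (@filter_ex _ s^'-); near=> t; split; near: t.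
  - exact: nbhs_left_lt.
  - exact: nbhs_left_gt.
  - rewrite -gp0; apply: (near_left_gt_derive_lt0 _ _ _ _ (gE p s (ltW as_))).
    exact: dg0.
by have := below p t (ltW at_) ts; rewrite ltNge (ltW gt).
Unshelve. all: end_near. Qed.

(** If [g t >= e], the slope bound [L] keeps [g] above [e / 2] on a window of length
    [eta = e / (2 * L)], so [Q] gains at least [d = e / 2 * eta] there. This is impossible once [Q]
    is within [d] of its supremum. *)
Lemma cvg0_le_derive_bounded (R : realType) (Q dQ g dg : R -> R) (a L M : R) :
  (forall t, a < t -> is_derive t 1 Q (dQ t)) ->
  (forall t, a < t -> Q t <= M) ->
  (forall t, a < t -> is_derive t 1 g (dg t)) ->
  (forall t, a < t -> `|dg t| <= L) ->
  (forall t, a < t -> 0 <= g t <= dQ t) ->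
  g t @[t --> +oo] --> (0 : R).
Proof.
move=> QE QM gE gL g0.
(* The bound may be enlarged; positivity makes the window length [eta] meaningful. *)
wlog L0 : L gL / 0 < L.
  move=> H; apply: (H (`|L| + 1)) => [t at_|]; last first.
    by rewrite (lt_le_trans ltr01)// lerDr.
  by rewrite (le_trans (gL t at_))// (le_trans (ler_norm L))// lerDl.
apply/cvgr0Pnorm_lt => e e0.
pose eta := e / (2 * L); have eta0 : 0 < eta by rewrite divr_gt0// mulr_gt0.
pose d := e / 2 * eta; have d0 : 0 < d by rewrite mulr_gt0// divr_gt0.
pose E := [set Q t | t in [set t | a < t]].
have hE : has_sup E.
  split; first by exists (Q (a + 1)), (a + 1) => //=; rewrite ltrDl.
  by exists M => _ [t at_ <-]; exact: QM.
have [_ [T /= aT <-] QT] := sup_adherent d0 hE.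
near=> t.
have Tt : T < t by near: t; apply: nbhs_pinfty_gt; exact: num_real.
have at_ := lt_trans aT Tt.
have /andP[gt0 _] := g0 t at_.
rewrite ger0_norm// ltNge; apply/negP => get.
(* Three mean values: [c1] gives [Q T <= Q t], [c2] expresses the gain of [Q] over the window, and
   [c3] bounds [g c2] from below. *)
have [|c1 /andP[Tc1 c1t] Q1] := @MVT_derive R Q dQ _ _ Tt.
  by move=> x /andP[Tx _]; apply: QE; rewrite (lt_le_trans aT).
have teta : t < t + eta by rewrite ltrDl.
have [|c2 /andP[tc2 c2t] Q2] := @MVT_derive R Q dQ _ _ teta.
  by move=> x /andP[Tx _]; apply: QE; rewrite (lt_le_trans at_).
have [|c3 /andP[tc3 c3t] g3] := @MVT_derive R g dg _ _ tc2.
  by move=> x /andP[Tx _]; apply: gE; rewrite (lt_le_trans at_).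
have ac1 := lt_trans aT Tc1; have ac2 := lt_trans at_ tc2.
have ac3 := lt_trans at_ tc3.
have gc2 : e / 2 <= g c2.
  have : - (e / 2) <= dg c3 * (c2 - t).
    have -> : - (e / 2) = (- L) * eta by rewrite /eta; field; rewrite gt_eqF.
    have : L * (c2 - t) <= L * eta.
      by rewrite ler_pM2l//; lra.
    have : (- L) * (c2 - t) <= dg c3 * (c2 - t).
      rewrite ler_pM2r ?subr_gt0//.
      by have := gL c3 ac3; rewrite ler_norml => /andP[].
    by lra.
  by lra.
have Q1' : 0 <= dQ c1 * (t - T).
  have /andP[? ?] := g0 c1 ac1.
  by rewrite mulr_ge0 ?subr_ge0 ?(ltW Tt)//; lra.
have Q2' : d <= dQ c2 * (t + eta - t).
  have /andP[? ?] := g0 c2 ac2.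
  have -> : t + eta - t = eta by ring.
  by rewrite ler_pM2r//; lra.
have : Q (t + eta) <= sup E.
  by apply: ub_le_sup; [exact: hE.2|exists (t + eta) => //=; lra].
by lra.
Unshelve. all: end_near. Qed.

(** * Derivatives of finite sums and products; zeros of the sine *)

Lemma is_derive_sum_fun (R : realType) (n : nat) (f : 'I_n -> R -> R)
    (df : 'I_n -> R) (x : R) :
  (forall i, is_derive x 1 (f i) (df i)) ->
  is_derive x 1 (fun t => \sum_(i < n) f i t) (\sum_(i < n) df i).
Proof.
move=> fE; rewrite (_ : (fun t => _) = \sum_(i < n) f i); last first.
  by apply/funext => t; rewrite fct_sumE.
exact: is_derive_sum.
Qed.

(** A logarithmic derivative stated without division, so that vanishing factors are allowed. *)
Lemma is_derive_prod_log (R : realType) (I : finType) (P : pred I)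
    (f : I -> R -> R) (h : I -> R) (x : R) :
  (forall i, P i -> is_derive x 1 (f i) (h i * f i x)) ->
  is_derive x 1 (fun t => \prod_(i | P i) f i t)
    ((\sum_(i | P i) h i) * \prod_(i | P i) f i x).
Proof.
move=> fE; elim: (index_enum I) => [|i s IH].
  rewrite !big_nil mul0r (_ : (fun t => _) = cst 1); last first.
    by apply/funext => t; rewrite big_nil.
  exact: is_derive_cst.
case: (boolP (P i)) => Pi; last first.
  rewrite !big_cons (negbTE Pi) (_ : (fun t => _) =
    (fun t => \prod_(j <- s | P j) f j t)) //.
  by apply/funext => t; rewrite big_cons (negbTE Pi).
rewrite !big_cons Pi (_ : (fun t => _) =
  f i * (fun t => \prod_(j <- s | P j) f j t)); last first.
  by apply/funext => t; rewrite big_cons Pi.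
have fi := fE i Pi; apply: is_derive_eq.
by rewrite /GRing.scale/=; ring.
Qed.

(** Subtracting [Num.floor (x / pi)] times [pi] moves [x] into [[0, pi)], where the sine vanishes
    only at 0. *)
Lemma sin_eq0_pi (R : realType) (x : R) :
  sin x = 0 -> exists m : int, x = m%:~R * pi.
Proof.
move=> sx0; set m := Num.floor (x / pi); exists m.
have sin0n (y : R) n : sin y = 0 -> sin (y + n%:R * pi) = 0.
  elim: n y => [|n IH] y sy; first by rewrite mul0r addr0.
  by rewrite -natr1 mulrDl mul1r addrA sinDpi IH// oppr0.
have sm : sin (x - m%:~R * pi) = 0.
  case: (m) => n.
    have := sin0n (- x) n; rewrite sinN sx0 oppr0 => /(_ erefl).
    by move=> H; rewrite -[X in sin X]opprK opprB addrC sinN H oppr0.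
  by rewrite NegzE mulrNz mulNr opprK sin0n.
have pi0 := pi_gt0 R.
have : 0 <= x - m%:~R * pi < pi.
  rewrite subr_ge0 ltrBlDr -ler_pdivlMr// ge_floor/=.
  rewrite -[X in X + _]mul1r -mulrDl -ltr_pdivrMr//.
  by rewrite addrC -intrD1 floorD1_gt.
rewrite le_eqVlt => /andP[/orP[/eqP/esym/eqP|x0 xpi]].
  by rewrite subr_eq0 => /eqP.
by have := sin_gt0_pi (x := x - m%:~R * pi); rewrite sm x0 xpi ltxx => /(_ isT).
Qed.

(** * The squared order parameter and trigonometric identities for the field *)

(** This is [R^2], expanded in phase differences: it is differentiable even where [R] vanishes. *)
Definition coherence (R : realType) (N : nat) (x : 'I_N -> R) : R :=
  (N%:R^-1) ^+ 2 * \sum_(i < N) \sum_(k < N) cos (x i - x k).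

Lemma coherenceE (R : realType) (N : nat) (x : 'I_N -> R) :
  coherence R N x = (N%:R^-1 * \sum_(i < N) cos (x i)) ^+ 2 +
                    (N%:R^-1 * \sum_(i < N) sin (x i)) ^+ 2.
Proof.
rewrite !exprMn -mulrDr; congr (_ * _); rewrite !expr2 !big_distrl/= -big_split/=.
apply: eq_bigr => i _; rewrite !big_distrr/= -big_split/=.
by apply: eq_bigr => k _; rewrite cosB.
Qed.

Lemma coherence_ge0 (R : realType) (N : nat) (x : 'I_N -> R) :
  0 <= coherence R N x.
Proof. by rewrite coherenceE addr_ge0// sqr_ge0. Qed.

Lemma order_parameterE (R : realType) (N : nat) (theta : 'I_N -> R -> R) (t : R) :
  order_parameter theta t = Num.sqrt (coherence R N (fun j => theta j t)).
Proof.
rewrite /order_parameter coherenceE.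
have -> : \sum_(j < N) expi (theta j t) =
    Complex (\sum_(j < N) cos (theta j t)) (\sum_(j < N) sin (theta j t)).
  by elim/big_rec3: _ => // i x y z _ ->.
have -> : N%:R^-1 = Complex (N%:R^-1) 0 :> R[i].
  by rewrite -[RHS]/((N%:R^-1)%:C%C) fmorphV rmorph_nat.
by rewrite /ComplexField.Normc.normc /= !mul0r subr0 addr0.
Qed.

Lemma cosB_sin (R : realType) (x y : R) :
  cos x - cos y = - 2 * sin ((x + y) / 2) * sin ((x - y) / 2).
Proof.
have -> : cos x = cos ((x + y) / 2 + (x - y) / 2) by congr cos; field.
have -> : cos y = cos ((x + y) / 2 - (x - y) / 2) by congr cos; field.
by rewrite cosD cosB; ring.
Qed.

Lemma sinD_sin_cos (R : realType) (x y : R) :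
  sin x + sin y = 2 * sin ((x + y) / 2) * cos ((x - y) / 2).
Proof.
have -> : sin x = sin ((x + y) / 2 + (x - y) / 2) by congr sin; field.
have -> : sin y = sin ((x + y) / 2 - (x - y) / 2) by congr sin; field.
by rewrite sinD sinB; ring.
Qed.

(** Up to a constant factor, the contribution of oscillator [i] to the logarithmic derivative of
    [sin ((x i - x j) / 2)]. *)
Definition sine_sum (R : realType) (N : nat) (alpha : R) (x : 'I_N -> R)
    (i : 'I_N) : R :=
  \sum_(k < N) sin (x i - x k + alpha).

(** By the addition formula, the part carrying [cos alpha] is antisymmetric in the two indices and
    cancels; the part carrying [sin alpha] is the double sum of cosines. *)
Lemma sum_sine_sum (R : realType) (N : nat) (alpha : R) (x : 'I_N -> R) :
  (0 < N)%N ->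
  \sum_(i < N) sine_sum R N alpha x i = sin alpha * (N%:R ^+ 2 * coherence R N x).
Proof.
move=> N0; have nN : N%:R != 0 :> R by rewrite pnatr_eq0 -lt0n.
rewrite /coherence [_ ^+ 2 * _]mulrA -exprMn divff// expr1n mul1r.
have S0 : \sum_(i < N) \sum_(k < N) sin (x i - x k) = 0.
  set A := (X in X = _); suff : A = - A by move=> H; lra.
  rewrite {1}/A exchange_big/= -sumrN; apply: eq_bigr => i _.
  by rewrite -sumrN; apply: eq_bigr => k _; rewrite -sinN opprB.
transitivity (\sum_(i < N) (\sum_(k < N) sin (x i - x k) * cos alpha +
    \sum_(k < N) cos (x i - x k) * sin alpha)).
  by apply: eq_bigr => i _; rewrite -big_split/=; apply: eq_bigr => k _; rewrite sinD.
rewrite big_split/=.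
under eq_bigr do rewrite -mulr_suml.
rewrite -mulr_suml S0 mul0r add0r mulrC mulr_suml.
by apply: eq_bigr => i _; rewrite mulr_suml.
Qed.

Lemma sum_off_diag (R : realType) (N : nat) (S : 'I_N -> R) :
  \sum_(i < N) \sum_(j < N | i != j) (S i + S j) =
  2 * (N%:R - 1) * \sum_(i < N) S i.
Proof.
set T := \sum_(i < N) S i.
have E i : \sum_(j < N | i != j) (S i + S j) = N%:R * S i + T - 2 * S i.
  have : \sum_(j < N) (S i + S j) = N%:R * S i + T.
    by rewrite big_split/= sumr_const card_ord mulr_natl.
  rewrite (bigD1 i)//= => <-.
  by under [in RHS]eq_bigl do rewrite eq_sym; ring.
under eq_bigr do rewrite E.
rewrite sumrB big_split/= -!mulr_sumr sumr_const card_ord -mulr_natl -/T.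
by ring.
Qed.

(** Sum-to-product on each term: [alpha] and [x k] cancel in the half difference, whose sine
    therefore factors out of the sum. *)
Lemma kuramoto_fieldB (R : realType) (N : nat) (kappa alpha : R) (x : 'I_N -> R)
    (i j : 'I_N) :
  kuramoto_field kappa alpha x i - kuramoto_field kappa alpha x j =
  - 2 * (kappa / N%:R) * sin ((x i - x j) / 2) *
    \sum_(k < N) sin ((x i + x j) / 2 - x k + alpha).
Proof.
rewrite /kuramoto_field -mulrBr -sumrB.
rewrite (eq_bigr (fun k => - 2 * sin ((x i - x j) / 2) *
   sin ((x i + x j) / 2 - x k + alpha))).
  by rewrite -mulr_sumr; ring.
move=> k _; rewrite cosB_sin.
have -> : (x i - x k + alpha + (x j - x k + alpha)) / 2 =
   (x i + x j) / 2 - x k + alpha by field.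
have -> : (x i - x k + alpha - (x j - x k + alpha)) / 2 =
   (x i - x j) / 2 by field.
by ring.
Qed.

Lemma kuramoto_field_bound (R : realType) (N : nat) (kappa alpha : R) (x : 'I_N -> R)
    (i : 'I_N) : 0 < kappa ->
  `|kuramoto_field kappa alpha x i| <= kappa.
Proof.
move=> k0; have N0 : (0 < N)%N by case: (N) i => // -[].
have nN : 0 < N%:R :> R by rewrite ltr0n.
rewrite /kuramoto_field normrM gtr0_norm ?divr_gt0//.
rewrite mulrAC ler_pdivrMr// ler_pM2l//.
rewrite (le_trans (ler_norm_sum _ _ _))//.
rewrite (@le_trans _ _ (\sum_(k < N) 1))//.
  by apply: ler_sum => k _; exact: cos_max.
by rewrite sumr_const card_ord.
Qed.

(** * Derivatives along the flow *)

Section Flow.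
Context (R : realType) (N : nat) (kappa alpha : R) (theta : 'I_N -> R -> R) (t : R).
Let x := fun k => theta k t.
Context (thetaE :
  forall j, is_derive t 1 (theta j) (kuramoto_field kappa alpha x j)).

(** The chain rule produces the cosine of the half difference, which sum-to-product absorbs into the
    two sine sums. What remains is a multiple of the differentiated sine itself. *)
Lemma is_derive_sin_half (i j : 'I_N) :
  is_derive t 1 (fun s => sin ((theta i s - theta j s) / 2))
    (- (kappa / N%:R) / 2 * (sine_sum R N alpha x i + sine_sum R N alpha x j) *
      sin ((x i - x j) / 2)).
Proof.
have hi := thetaE i; have hj := thetaE j.
have h : is_derive t 1 (2^-1 *: (theta i - theta j))
  (2^-1 * (kuramoto_field kappa alpha x i - kuramoto_field kappa alpha x j)).
  exact: is_derive_eq.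
have -> : (fun s => sin ((theta i s - theta j s) / 2)) =
   sin \o (2^-1 *: (theta i - theta j)).
  by apply/funext => s; rewrite /= mulrC.
have := @is_derive1_comp _ _ _ _ _ _ (is_derive_sin _) h.
move/is_derive_eq; apply.
rewrite kuramoto_fieldB.
have -> : (2^-1 *: (theta i - theta j)) t = (x i - x j) / 2.
  by rewrite /x mulrC.
have -> : sine_sum R N alpha x i + sine_sum R N alpha x j =
   2 * cos ((x i - x j) / 2) * \sum_(k < N) sin ((x i + x j) / 2 - x k + alpha).
  rewrite /sine_sum -big_split mulr_sumr; apply: eq_bigr => k _ /=.
  rewrite sinD_sin_cos.
  have -> : (x i - x k + alpha + (x j - x k + alpha)) / 2 =
     (x i + x j) / 2 - x k + alpha by field.
  have -> : (x i - x k + alpha - (x j - x k + alpha)) / 2 =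
     (x i - x j) / 2 by field.
  by ring.
by rewrite /GRing.scale/=; set c := kappa / N%:R; field.
Qed.

(** Up to sign and a power of 2, the discriminant of the points [expi (theta i s)] on the unit
    circle, since a chord has length twice the absolute sine of half the angle. *)
Definition discriminant (s : R) : R :=
  \prod_(i < N) \prod_(j < N | i != j) sin ((theta i s - theta j s) / 2).

(** The logarithmic derivatives add up over ordered pairs; each sine sum is counted [2 * (N - 1)]
    times, and their total is a multiple of the coherence. *)
Lemma is_derive_discriminant : (0 < N)%N ->
  is_derive t 1 discriminant
    (- kappa * sin alpha * N%:R * (N%:R - 1) * coherence R N x * discriminant t).
Proof.
move=> N0; have nN : N%:R != 0 :> R by rewrite pnatr_eq0 -lt0n.
have := @is_derive_prod_log R 'I_N xpredT
  (fun i s => \prod_(j < N | i != j) sin ((theta i s - theta j s) / 2))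
  (fun i => \sum_(j < N | i != j)
     - (kappa / N%:R) / 2 * (sine_sum R N alpha x i + sine_sum R N alpha x j)) t.
move=> H; have /is_derive_eq := H (fun i _ => @is_derive_prod_log R 'I_N _ _ _ t
   (fun j _ => is_derive_sin_half i j)); apply.
rewrite -/(discriminant t); congr (_ * _).
under eq_bigr do rewrite -mulr_sumr.
rewrite -mulr_sumr sum_off_diag sum_sine_sum//.
by field.
Qed.

Lemma is_derive_coherence :
  is_derive t 1 (fun s => coherence R N (fun j => theta j s))
   ((N%:R^-1) ^+ 2 * \sum_(i < N) \sum_(k < N) - sin (x i - x k) *
      (kuramoto_field kappa alpha x i - kuramoto_field kappa alpha x k)).
Proof.
have h i k : is_derive t 1 (fun s => cos (theta i s - theta k s)) (- sin (x i - x k) *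
      (kuramoto_field kappa alpha x i - kuramoto_field kappa alpha x k)).
  have hi := thetaE i; have hk := thetaE k.
  have h : is_derive t 1 (theta i - theta k)
    (kuramoto_field kappa alpha x i - kuramoto_field kappa alpha x k).
    exact: is_derive_eq.
  exact: (@is_derive1_comp _ _ _ _ _ _ (is_derive_cos _) h).
have h2 := is_derive_sum_fun _ _ _ _ _ (fun i => is_derive_sum_fun _ _ _ _ _ (h i)).
have h3 := @is_deriveZ _ _ _ _ ((N%:R^-1) ^+ 2) _ _ _ h2.
exact: h3.
Qed.

Lemma derive_coherence_bound : 0 < kappa -> (0 < N)%N ->
  `|(N%:R^-1) ^+ 2 * \sum_(i < N) \sum_(k < N) - sin (x i - x k) *
      (kuramoto_field kappa alpha x i - kuramoto_field kappa alpha x k)| <=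
  2 * kappa.
Proof.
move=> k0 N0; have nN : 0 < N%:R :> R by rewrite ltr0n.
rewrite normrM ger0_norm ?sqr_ge0// exprVn ler_pdivrMl ?exprn_gt0//.
rewrite (@le_trans _ _ (\sum_(i < N) \sum_(k < N) (2 * kappa)))//; last first.
  by rewrite !sumr_const !card_ord -mulrnA -[X in X <= _]mulr_natl natrM expr2 lexx.
rewrite (le_trans (ler_norm_sum _ _ _))//; apply: ler_sum => i _.
rewrite (le_trans (ler_norm_sum _ _ _))//; apply: ler_sum => k _.
rewrite normrM normrN.
rewrite (@le_trans _ _ (1 * (kappa + kappa)))//; last by lra.
apply: ler_pM => //; first exact: sin_max.
by rewrite (le_trans (ler_normB _ _))// lerD// kuramoto_field_bound.
Qed.

End Flow.

(** * Long-time limits in the repulsive and attractive cases *)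

Section Asymptotics.
Context (R : realType) (N : nat) (kappa alpha : R) (theta : 'I_N -> R -> R).
Context (N_gt0 : (0 < N)%N) (kappa_gt0 : 0 < kappa).
Context (thetaE : forall t : R, 0 < t -> forall j,
  is_derive t 1 (theta j) (kuramoto_field kappa alpha (fun k => theta k t) j)).

Lemma discriminant_sqr_le1 (t : R) : discriminant R N theta t ^+ 2 <= 1.
Proof.
rewrite -real_normK ?num_real// expr_le1//; rewrite normr_prod prodr_ile1// => i _.
rewrite normr_ge0/= normr_prod prodr_ile1// => j _.
by rewrite normr_ge0/= sin_max.
Qed.

Lemma coherence_cvg0 (t0 : R) : 0 < t0 -> sin alpha < 0 -> (1 < N)%N ->
  discriminant R N theta t0 != 0 ->
  coherence R N (fun j => theta j t) @[t --> +oo] --> (0 : R).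
Proof.
move=> t00 sa N1 P0.
pose P := discriminant R N theta; pose g t := coherence R N (fun j => theta j t).
pose C : R := - kappa * sin alpha * N%:R * (N%:R - 1).
have C0 : 0 < C.
  have N1' : 1 < N%:R :> R by rewrite ltr1n.
  by rewrite /C mulr_gt0 ?subr_gt0// mulr_gt0 ?ltr0n// mulNr -mulrN mulr_gt0// oppr_gt0.
pose q := P t0 ^+ 2; have q0 : 0 < q by rewrite exprn_even_gt0.
have g0 t : 0 <= g t by exact: coherence_ge0.
have PE (t : R) : 0 < t -> is_derive t 1 (P * P) (2 * C * g t * P t ^+ 2).
  move=> t_gt0; have := is_derive_discriminant _ _ _ _ _ _ (thetaE t t_gt0) N_gt0.
  rewrite -/P -/C -/(g t) => h; apply: is_derive_eq.
  by rewrite /GRing.scale/=; ring.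
clearbody C.
(* The derivative of [P ^+ 2] is nonnegative because [C > 0]. *)
have qP t : t0 < t -> q <= P t ^+ 2.
  move=> t0t; have [|c /andP[t0c _]] :=
    MVT_derive R (P * P) (fun t => 2 * C * g t * P t ^+ 2) _ _ t0t.
    by move=> x /andP[t0x _]; apply: PE; rewrite (lt_le_trans t00).
  rewrite -[(P * P) t]/(P t ^+ 2) -[(P * P) t0]/q => E.
  rewrite -subr_ge0 E; apply: mulr_ge0; last by rewrite subr_ge0 ltW.
  apply: mulr_ge0; last exact: sqr_ge0.
  exact: (mulr_ge0 (mulr_ge0 (ler0n _ 2) (ltW C0)) (g0 c)).
have C2q : 0 < 2 * C * q by rewrite mulr_gt0 ?q0 ?mulr_gt0 ?ltr0n.
(* Scaling by [(2 * C * q)^-1] turns the derivative of [P * P] into [g t * P t ^+ 2 / q], which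
   dominates [g t] by [qP]. *)
apply: (cvg0_le_derive_bounded R ((2 * C * q)^-1 *: (P * P))
  (fun t => (2 * C * q)^-1 * (2 * C * g t * P t ^+ 2)) g
  _ t0 (2 * kappa) (2 * C * q)^-1).
- move=> t t0t; apply: is_deriveZ; apply: PE; exact: lt_trans t0t.
- move=> t t0t; rewrite -[X in X <= _]/((2 * C * q)^-1 * P t ^+ 2).
  by apply: ler_piMr; [rewrite invr_ge0 ltW|exact: discriminant_sqr_le1].
- move=> t t0t; exact: (is_derive_coherence _ _ _ _ _ _ (thetaE t (lt_trans t00 t0t))).
- move=> t t0t; exact: derive_coherence_bound.
- move=> t t0t; rewrite g0/=.
  rewrite ler_pdivlMl//.
  rewrite mulrAC; apply: ler_wpM2l; last exact: qP.
  exact: (mulr_ge0 (mulr_ge0 (ler0n _ 2) (ltW C0)) (g0 t)).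
Qed.

Lemma diameter_cvg0 (t0 D : R) : 0 < t0 -> 0 < alpha < pi / 2 ->
  0 < D < 2 * alpha ->
  (forall i j, theta i t0 - theta j t0 < D) ->
  forall i j, theta i t - theta j t @[t --> +oo] --> (0 : R).
Proof.
move=> t00 /andP[al0 al1] /andP[D0 D1] th0.
(* The minimum of the sine on [[alpha - D / 2, alpha + D / 2]]: it sits at the left end because
   [alpha < pi / 2]. *)
pose m := sin (alpha - D / 2); have m0 : 0 < m.
  by apply: sin_gt0_pi; apply/andP; split; have := pi_gt0 R; lra.
have ca0 : 0 < cos alpha by apply: cos_gt0_pihalf; apply/andP; split; lra.
(* Half the rate available at contact: there the phase difference has derivative at most
   [- 2 * c * f t], strictly below the barrier's slope [- c * f t]. *)
pose c := kappa * m * cos alpha / 2.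
have c0 : 0 < c by rewrite !mulr_gt0// invr_gt0.
pose f t := D * expR (- c * (t - t0)).
have fE (t : R) : is_derive t 1 f (- c * f t).
  have h1 : is_derive t 1 (- c *: (id - cst t0)) (- c * (1 - 0)).
    exact: is_derive_eq.
  have h2 := @is_derive1_comp _ _ _ _ _ _ (is_derive_expR _) h1.
  have h3 := @is_deriveZ _ _ _ _ D _ _ _ h2.
  move/is_derive_eq : h3; apply.
  by rewrite /f /GRing.scale/= subr0 mulr1 -[(_ - _) t]/(t - t0); ring.
have f0 t : 0 < f t by rewrite mulr_gt0// expR_gt0.
have fD t : t0 < t -> f t <= D.
  move=> t0t; rewrite ler_piMr ?(ltW D0)// -expR0 ler_expR.
  by rewrite mulNr oppr_le0 mulr_ge0 ?subr_ge0 ?(ltW c0) ?(ltW t0t).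
have main i j t : t0 <= t -> theta i t - theta j t < f t.
  move=> t0t; rewrite -subr_lt0.
  pose g (p : 'I_N * 'I_N) : R -> R := theta p.1 - theta p.2 - f.
  pose F t j := kuramoto_field kappa alpha (fun k => theta k t) j.
  apply: (barrier R _ g (fun p t => F t p.1 - F t p.2 - (- c * f t))
    t0 _ _ _ (i, j) t t0t).
  - move=> {i j t t0t} [i j] t t0t.
    have t_gt0 := lt_le_trans t00 t0t.
    have hi := thetaE t t_gt0 i; have hj := thetaE t t_gt0 j; have hf := fE t.
    exact: is_derive_eq.
  - move=> p; rewrite /g -[_ < _]/(theta p.1 t0 - theta p.2 t0 - f t0 < 0).
    by rewrite subr_lt0 /f subrr mulr0 expR0 mulr1.
  - move=> {i j t t0t} [i j] t t0t gle ge /=.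
    have le p q : theta p t - theta q t <= f t.
      by rewrite -subr_le0; exact: (gle (p, q)).
    have {}ge : theta i t - theta j t = f t.
      by apply/eqP; rewrite -subr_eq0; apply/eqP; exact: ge.
    rewrite /F (kuramoto_fieldB R N kappa alpha (fun k => theta k t)) ge.
    have fD' := fD t t0t; have f0' := f0 t.
    (* By the mean value theorem the quotient is some [cos z] with [0 < z < f t / 2 < alpha], and
       the cosine decreases there. *)
    have sh : f t / 2 * cos alpha <= sin (f t / 2).
      have h0 : 0 < f t / 2 by lra.
      have [z /andP[z0 z1]] := MVT_derive _ sin cos _ _ h0.
      rewrite sin0 !subr0 => ->; rewrite mulrC ler_pM2r//.
      rewrite le_eqVlt; apply/orP; right; rewrite ltr_cos ?in_itv/=; first lra.
      + by apply/andP; split; lra.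
      + by apply/andP; split; lra.
    (* At contact [i] and [j] are extremal, so [theta k] is within [f t / 2] of their midpoint. As
       [alpha + a] may pass [pi / 2], the addition formula is compared term by term. *)
    have sk k : m <= sin ((theta i t + theta j t) / 2 - theta k t + alpha).
      have := le i k; have := le k j => h1 h2.
      set a := (theta i t + theta j t) / 2 - theta k t.
      have aD : - (D / 2) <= a <= D / 2 by apply/andP; split; rewrite /a; lra.
      case/andP: aD => aD1 aD2.
      have ca : cos (D / 2) <= cos a.
        rewrite -(cos_norm a) le_eqVlt; have [->|aD] := eqVneq `|a| (D / 2).
          by rewrite eqxx.
        have aD' : `|a| < D / 2 by rewrite lt_neqAle aD ler_norml aD1.
        have := normr_ge0 a => a0.
        by apply/orP; right; rewrite ltr_cos// in_itv/=; apply/andP; split; lra.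
      have sa : - sin (D / 2) <= sin a.
        rewrite -sinN le_eqVlt; have [->|aD] := eqVneq a (- (D / 2)).
          by rewrite eqxx.
        have aD' : - (D / 2) < a by rewrite lt_neqAle eq_sym aD.
        by apply/orP; right; rewrite ltr_sin// in_itv/=; apply/andP; split; lra.
      have sal : 0 < sin alpha by apply: sin_gt0_pihalf; rewrite al0.
      rewrite /m sinB sinD.
      have e1 : 0 <= sin alpha * (cos a - cos (D / 2)) by rewrite mulr_ge0//; lra.
      have e2 : 0 <= cos alpha * (sin a + sin (D / 2)) by rewrite mulr_ge0//; lra.
      by lra.
    have nN : 0 < N%:R :> R by rewrite ltr0n.
    have sum_ge : N%:R * m <=
        \sum_(k < N) sin ((theta i t + theta j t) / 2 - theta k t + alpha).
      rewrite (@le_trans _ _ (\sum_(k < N) m))//; last exact: ler_sum.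
      by rewrite sumr_const card_ord mulr_natl.
    have : kappa / N%:R * (f t / 2 * cos alpha) * (N%:R * m) <=
        kappa / N%:R * sin (f t / 2) *
        \sum_(k < N) sin ((theta i t + theta j t) / 2 - theta k t + alpha).
      apply: ler_pM => //.
      + by rewrite !mulr_ge0// ?invr_ge0 ltW.
      + by rewrite mulr_ge0// ltW.
      + by rewrite ler_pM2l// divr_gt0.
    have -> : kappa / N%:R * (f t / 2 * cos alpha) * (N%:R * m) = c * f t.
      by rewrite /c; field; rewrite gt_eqF.
    have cf : 0 < c * f t by rewrite mulr_gt0.
    by lra.
have fcvg : f t @[t --> +oo] --> (0 : R).
  have lin : c * (t - t0) @[t --> +oo] --> +oo.
    apply/cvgryPge => A; near=> t.
    have : A / c + t0 <= t by near: t; apply: nbhs_pinfty_ge; exact: num_real.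
    by rewrite -lerBrDr ler_pdivrMr// mulrC.
  rewrite (_ : f = (fun t => D * expR (- (c * (t - t0))))); last first.
    by apply/funext => t; rewrite /f mulNr.
  rewrite -[X in _ --> X](mulr0 D); apply: cvgMl_tmp.
  exact: (cvg_comp _ (fun y : R => expR (- y)) lin (@cvgr_expR R)).
move=> i j; apply: (@squeeze_cvgr _ _ _ _ (- f) f).
- near=> t.
  have t0t : t0 <= t by near: t; apply: nbhs_pinfty_ge; exact: num_real.
  have := main i j t t0t; have := main j i t t0t => h1 h2.
  by rewrite -[(- f) t]/(- f t); apply/andP; split; lra.
- by rewrite -oppr0; apply: cvgN.
- exact: fcvg.
Unshelve. all: end_near. Qed.

Lemma coherence_cvg1 :
  (forall i j, theta i t - theta j t @[t --> +oo] --> (0 : R)) ->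
  coherence R N (fun j => theta j t) @[t --> +oo] --> (1 : R).
Proof.
move=> th0; have nN : N%:R != 0 :> R by rewrite pnatr_eq0 -lt0n.
(* Writing 1 as the same double sum with every cosine equal to [cos 0] reduces the limit to single
   terms. *)
have -> : (1 : R) = N%:R^-1 ^+ 2 * \sum_(i < N) \sum_(k < N) 1.
  by rewrite !sumr_const !card_ord -mulrnA natrM -expr2 -exprMn mulVf// expr1n.
apply: cvgMl_tmp.
apply: cvg_big => [|i _]; first exact: add_continuous.
apply: cvg_big => [|k _]; first exact: add_continuous.
rewrite -(@cos0 R); apply: continuous_cvg; first exact: continuous_cos.
exact: th0.
Qed.

End Asymptotics.

(** * From the initial data to the dichotomy *)

Lemma le_phase_diameter (R : realType) (N : nat) (x : 'I_N -> R) (i j : 'I_N) :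
  `|x i - x j| <= phase_diameter x.
Proof.
apply: (@bigmax_sup_seq _ _ _ _ _ i _ _ _ (mem_index_enum i) isT).
exact: (@le_bigmax_seq _ _ _ _ _ j _ (fun j => `|x i - x j|) (mem_index_enum j) isT).
Qed.

Theorem corollary3p1 (R : realType) (N : nat) (kappa alpha : R)
    (theta0 : 'I_N -> R) (theta : 'I_N -> R -> R)
    (HN : (0 < N)%N) (Hkappa : 0 < kappa)
    (Hsol : kuramoto_solution kappa alpha theta0 theta) :
  (0 < alpha < pi / 2 -> phase_diameter theta0 < 2 * alpha ->
     order_parameter theta t @[t --> +oo] --> (1 : R)) /\
  (- (pi / 2) < alpha < 0 -> (1 < N)%N -> distinct_phases theta0 ->
     order_parameter theta t @[t --> +oo] --> (0 : R)).
Proof.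
have thetaE : forall t : R, 0 < t -> forall j,
    is_derive t 1 (theta j) (kuramoto_field kappa alpha (fun k => theta k t) j).
  by move=> t t0 j; case: (Hsol j) => _ _; apply.
(* One-sided continuity at 0 carries the strict initial conditions, finite in number, to a common
   positive time. *)
have theta_init j : theta j t @[t --> 0^'+] --> theta0 j.
  by case: (Hsol j) => /continuous_within_itvcyP[_ +] <- _.
have -> : order_parameter theta =
    fun t => Num.sqrt (coherence R N (fun j => theta j t)).
  by apply/funext => t; exact: order_parameterE.
have sqrt_cvg (l : R) : coherence R N (fun j => theta j t) @[t --> +oo] --> l ->
    Num.sqrt (coherence R N (fun j => theta j t)) @[t --> +oo] --> Num.sqrt l.
  by move=> cl; apply: continuous_cvg => //; exact: sqrt_continuous.
split=> [alphaP diamP|/andP[alpha_gt alpha0] N1 distP].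
- rewrite -sqrtr1; apply/sqrt_cvg/coherence_cvg1 => //.
  (* The midpoint leaves room on both sides: above the initial diameter and below [2 * alpha]. *)
  pose D := (phase_diameter theta0 + 2 * alpha) / 2.
  have diam0 : 0 <= phase_diameter theta0.
    exact: le_trans (normr_ge0 _) (le_phase_diameter _ _ _ (Ordinal HN) (Ordinal HN)).
  have /andP[al0 _] := alphaP.
  have DP : 0 < D < 2 * alpha by apply/andP; split; rewrite /D; lra.
  have [t0 [t00 thD]] : exists t0 : R,
      0 < t0 /\ forall i j, theta i t0 - theta j t0 < D.
    apply: (@filter_ex _ (0 : R)^'+); near=> t; split; near: t.
      exact: nbhs_right_gt.
    apply: filter_forall => i; apply: filter_forall => j.
    have cij : theta i t - theta j t @[t --> 0^'+] --> theta0 i - theta0 j.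
      exact: cvgB.
    apply: (cvgr_lt _ cij); rewrite (le_lt_trans (ler_norm _))//.
    by rewrite (le_lt_trans (le_phase_diameter _ _ _ i j))// /D; lra.
  exact: (diameter_cvg0 _ _ kappa alpha _ _ _ _ t0 D).
- rewrite -sqrtr0; apply: sqrt_cvg.
  have sa : sin alpha < 0.
    by rewrite -oppr_gt0 -sinN sin_gt0_pihalf// oppr_gt0 alpha0 ltrNl.
  have [t0 [t00 thD]] : exists t0 : R,
      0 < t0 /\ forall i j, i != j -> sin ((theta i t0 - theta j t0) / 2) != 0.
    apply: (@filter_ex _ (0 : R)^'+); near=> t; split; near: t.
      exact: nbhs_right_gt.
    apply: filter_forall => i; apply: filter_forall => j.
    have [->|ij] := eqVneq i j; first by near=> t.
    have cij : sin ((theta i t - theta j t) / 2) @[t --> 0^'+] -->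
        sin ((theta0 i - theta0 j) / 2).
      apply: continuous_cvg; first exact: continuous_sin.
      by apply: cvgMr_tmp; exact: cvgB.
    (* A zero would make the half difference a multiple of [pi], hence the two phases equal on the
       circle. *)
    have s0 : sin ((theta0 i - theta0 j) / 2) != 0.
      apply/eqP => /sin_eq0_pi[m mE]; have /eqP := distP i j m ij; apply.
      by rewrite mulrCA -mE; field.
    by apply: filterS (cvgr_neq0 _ cij s0) => t.
  apply: (coherence_cvg0 _ _ kappa alpha _ _ _ _ t0) => //.
  by apply/prodf_neq0 => i _; apply/prodf_neq0 => j ij; exact: thD.
Unshelve. all: end_near. Qed.
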